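(* Let $A_0,A_1\in\mathbb{R}^{n\times n}$ be symmetric matrices with $A_1$ positive definite. Then the Rayleigh quotient problem $$\min_{0\neq x\in\mathbb{R}^n}\ \frac{x^TA_0x}{x^TA_1x}$$ has no local non-global minimizer.
   Context: A local non-global minimizer is a local minimizer that is not a global minimizer; the feasible set here is $\mathbb{R}^n\setminus\{0\}$. *)

(* Defs.v *)
From mathcomp Require Import all_boot all_order all_algebra.
From mathcomp Require Import all_classical all_reals all_analysis.

Set Implicit Arguments.
Unset Strict Implicit.
Unset Printing Implicit Defensive.

Import Order.TTheory GRing.Theory Num.Theory.
Import numFieldNormedType.Exports.

Local Open Scope classical_set_scope.
Local Open Scope ring_scope.

(* The 1 x 1 matrix x^T A x is identified with its unique entry. *)
Definition quad_form (R : realType) (n : nat) (A : 'M[R]_n) (x : 'cV[R]_n) : R :=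
  (x^T *m A *m x) 0 0.

(* Symmetry is stated separately. *)
Definition positive_definite (R : realType) (n : nat) (A : 'M[R]_n) : Prop :=
  forall x : 'cV[R]_n, x != 0 -> 0 < quad_form A x.

Definition rayleigh_quotient (R : realType) (n : nat) (A0 A1 : 'M[R]_n)
    (x : 'cV[R]_n) : R :=
  quad_form A0 x / quad_form A1 x.

Definition global_minimizer (R : realType) (T : Type) (D : set T) (f : T -> R)
    (x : T) : Prop :=
  D x /\ forall y, D y -> f x <= f y.

Definition local_minimizer (R : realType) (T : topologicalType) (D : set T)
    (f : T -> R) (x : T) : Prop :=
  D x /\ \forall y \near x, D y -> f x <= f y.

Definition local_nonglobal_minimizer (R : realType) (T : topologicalType)
    (D : set T) (f : T -> R) (x : T) : Prop :=
  local_minimizer D f x /\ ~ global_minimizer D f x.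

(* Main.v *)
Require Import Defs.
From mathcomp Require Import all_boot all_order all_algebra.
From mathcomp Require Import all_classical all_reals all_analysis.
From mathcomp Require Import ring lra.

Set Implicit Arguments.
Unset Strict Implicit.
Unset Printing Implicit Defensive.

Import Order.TTheory GRing.Theory Num.Theory.
Import numFieldNormedType.Exports.

Local Open Scope classical_set_scope.
Local Open Scope ring_scope.

(** Fix a level [l] and put [B := A0 - l *: A1].  As [A1] is positive definite,
    the Rayleigh quotient of a nonzero [y] is at least [l] if and only if
    [quad_form B y] is nonnegative ([rayleigh_geE]), so comparisons of quotients
    with [l] are sign conditions on one quadratic form.

    Let [x] be a local minimizer and [l] its value.  Then [quad_form B] vanishes
    at [x] and is nonnegative near [x].  A quadratic form with these two
    properties is nonnegative everywhere ([quad_form_ge0_near]): along a line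
    through [x] it is the parabola [t * c + t ^+ 2 * quad_form B y], which is
    nonnegative for small [t] of both signs only if its leading coefficient is
    nonnegative.  Hence [l] is a lower bound of the quotient on all nonzero
    vectors, that is, [x] is a global minimizer. *)

Lemma quad_form0 (R : realType) (n : nat) (A : 'M[R]_n) : quad_form A 0 = 0.
Proof. by rewrite /quad_form mulmx0 mxE. Qed.

Lemma quad_formBZ (R : realType) (n : nat) (A0 A1 : 'M[R]_n) (l : R)
    (x : 'cV[R]_n) :
  quad_form (A0 - l *: A1) x = quad_form A0 x - l * quad_form A1 x.
Proof. by rewrite /quad_form mulmxBr mulmxBl -scalemxAr -scalemxAl !mxE. Qed.

Lemma quad_form_line (R : realType) (n : nat) (A : 'M[R]_n) (x y : 'cV[R]_n)
    (t : R) :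
  quad_form A (x + t *: y) =
  quad_form A x + t * (x^T *m A *m y + y^T *m A *m x) 0 0
    + t ^+ 2 * quad_form A y.
Proof.
have tr : (x + t *: y)^T = x^T + t *: y^T by apply/matrixP=> i j; rewrite !mxE.
rewrite /quad_form tr !(mulmxDl, mulmxDr).
rewrite -!(scalemxAl, scalemxAr) !mxE; ring.
Qed.

(** Continuity of [t |-> x + t *: y] transports a neighborhood of [x] to a
    symmetric interval of parameters around 0; the symmetry leaves the sign of
    [t] free. *)
Lemma near_line (R : realType) (V : normedModType R) (P : set V) (x y : V) :
  (\forall z \near x, P z) ->
  exists2 t : R, 0 < t & P (x + t *: y) /\ P (x + (- t) *: y).
Proof.
move=> /nbhs0P /(near0Z y) /nbhs_ballP[e /= e0 Pe].
exists (e / 2); first by rewrite divr_gt0.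
have e2 : `|e / 2| < e by rewrite gtr0_norm ?divr_gt0//; lra.
by split; apply: Pe; rewrite -ball_normE /= sub0r ?opprK ?normrN.
Qed.

(** Along a line through [x] the linear term of the form is odd in [t], so adding
    the values at [t] and [- t] isolates the quadratic term, whose coefficient
    is the value of the form at the arbitrary direction [y]. *)
Lemma quad_form_ge0_near (R : realType) (n : nat) (A : 'M[R]_n)
    (x : 'cV[R]_n) :
  quad_form A x = 0 -> (\forall z \near x, 0 <= quad_form A z) ->
  forall y, 0 <= quad_form A y.
Proof.
move=> Ax0 Ax y; have [t t0 []] := near_line y Ax.
rewrite !quad_form_line Ax0 sqrrN => Ap An.
rewrite -(pmulr_rge0 _ (exprn_gt0 2 t0)); lra.
Qed.

Lemma rayleigh_geE (R : realType) (n : nat) (A0 A1 : 'M[R]_n) (l : R)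
    (y : 'cV[R]_n) : positive_definite A1 -> y != 0 ->
  (l <= rayleigh_quotient A0 A1 y) = (0 <= quad_form (A0 - l *: A1) y).
Proof.
by move=> pA1 y0; rewrite quad_formBZ subr_ge0 /rayleigh_quotient
  ler_pdivlMr ?pA1.
Qed.

Theorem corollary3p5 (R : realType) (n : nat) (A0 A1 : 'M[R]_n)
    (symA0 : A0^T = A0) (symA1 : A1^T = A1) (posA1 : positive_definite A1) :
  ~ exists x : 'cV[R]_n,
      local_nonglobal_minimizer [set y : 'cV[R]_n | y != 0]
        (rayleigh_quotient A0 A1) x.
Proof.
case=> x [[/= x0 xmin]]; apply; split=> //= y y0.
rewrite rayleigh_geE //; apply: (quad_form_ge0_near (x := x)).
  by rewrite quad_formBZ /rayleigh_quotient divfK ?subrr // gt_eqF ?posA1.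
apply: filterS xmin => z zmin.
(* The form is nonnegative at the origin too, where the quotient is not
   constrained. *)
have [->|z0] := eqVneq z 0; first by rewrite quad_form0.
by rewrite -rayleigh_geE // zmin.
Qed.
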